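(* Let all spaces be completely regular Hausdorff. The following statements hold. (1) Let $X$ be a dense $z$-embedded subspace of a space $Y$. Then $X$ is a $WCF$-space if and only if $Y$ is a $WCF$-space. (2) Let $X$ be a dense $C^*$-embedded subspace of a space $Y$. Then $X$ is a $WCF$-space if and only if $Y$ is a $WCF$-space. (3) Every cozero-set in a $WCF$-space is (as a subspace) a $WCF$-space.
   Context: For a space $X$, $C(X)$ is the ring of real-valued continuous functions on $X$ and $C^*(X)$ the subring of bounded ones. For $f\in C(X)$, the zero-set of $f$ is $Z(f)=f^{-1}(\{0\})$ and the cozero-set of $f$ is $\mathrm{Coz}(f)=X\setminus Z(f)$. A space $X$ is a $WCF$-space if for every two disjoint cozero-sets $A,B$ of $X$ there exist zero-sets $Z_1,Z_2$ of $X$ with $A\subseteq Z_1$, $B\subseteq Z_2$ and $\mathrm{int}\,Z_1\cap \mathrm{int}\,Z_2=\emptyset$. A subspace $X\subseteq Y$ is $z$-embedded in $Y$ if every zero-set of $X$ is of the form $Z\cap X$ for some zero-set $Z$ of $Y$; it is $C^*$-embedded in $Y$ if every function in $C^*(X)$ extends to a function in $C^*(Y)$. *)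

(* Defs.v *)
From HB Require Import structures.
From mathcomp Require Import all_boot all_order all_algebra.
From mathcomp Require Import all_classical all_reals all_analysis.

Set Implicit Arguments.
Unset Strict Implicit.
Unset Printing Implicit Defensive.

Import Order.TTheory GRing.Theory Num.Theory.
Import numFieldNormedType.Exports.

Local Open Scope classical_set_scope.
Local Open Scope ring_scope.

(* A subspace [X] of [Y] is a set [X : set Y], viewed as a space through the
   type [set_type X], which carries the initial topology of the inclusion
   [set_val : X -> Y], i.e. the usual subspace topology.  (The library type
   [subspace X] keeps the points outside [X] as isolated points, so it is not
   the subspace as a space of its own.)  The reals are an arbitrary
   [R : realType]. *)

Definition tychonoff_space (T : topologicalType) : Prop :=
  completely_regular_space T /\ hausdorff_space T.

Section ZeroSets.
Variables (R : realType) (T : topologicalType).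

Definition zero_set (f : T -> R) : set T := f @^-1` [set 0].

Definition cozero_set (f : T -> R) : set T := [set: T] `\` zero_set f.

Definition is_zero_set (Z : set T) : Prop :=
  exists2 f : T -> R, continuous f & Z = zero_set f.

Definition is_cozero_set (A : set T) : Prop :=
  exists2 f : T -> R, continuous f & A = cozero_set f.

End ZeroSets.

Definition WCF_space (R : realType) (T : topologicalType) : Prop :=
  forall A B : set T,
    is_cozero_set R A -> is_cozero_set R B -> A `&` B = set0 ->
    exists Z1 Z2 : set T,
      [/\ is_zero_set R Z1, is_zero_set R Z2, A `<=` Z1, B `<=` Z2
        & interior Z1 `&` interior Z2 = set0].

Section Embeddings.
Variables (R : realType) (Y : topologicalType).

(* [set_val @^-1` Z] is the trace of [Z] on [X], as a set of points of the
   space [set_type X]. *)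
Definition z_embedded (X : set Y) : Prop :=
  forall W : set (set_type X), is_zero_set R W ->
    exists2 Z : set Y, is_zero_set R Z & W = set_val @^-1` Z.

Definition Cstar_embedded (X : set Y) : Prop :=
  forall f : set_type X -> R, continuous f -> bounded_fun f ->
    exists g : Y -> R,
      [/\ continuous g, bounded_fun g & forall x : set_type X, g (set_val x) = f x].

End Embeddings.

(* Main.v *)
(* For [Z] closed in [Y], taking interiors commutes with taking traces on [X]
   when [X] is dense, and an open subset of [Y] is empty as soon as its trace on
   a dense [X] is; so the separating zero-sets pass back and forth between [X]
   and [Y].  Normalizing a function to [0, 1] does not change its zero-set,
   hence C*-embedded subspaces are z-embedded.  A cozero-set of a cozero-set
   of [Y] is a cozero-set of [Y], so on a cozero-set the separation problem is
   solved in [Y] and restricted. *)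

Require Import Defs.
From mathcomp Require Import all_boot all_order all_algebra.
From mathcomp Require Import all_classical all_reals all_analysis.

Set Implicit Arguments.
Unset Strict Implicit.
Unset Printing Implicit Defensive.

Import Order.TTheory GRing.Theory Num.Theory.
Import numFieldNormedType.Exports.

Local Open Scope classical_set_scope.
Local Open Scope ring_scope.

Section ZeroSetTheory.
Variables (R : realType) (T : topologicalType).
Implicit Types (A Z : set T) (f : T -> R).

Lemma zero_set_closed Z : is_zero_set R Z -> closed Z.
Proof.
case=> f fc ->; apply: closed_comp => [x _|]; first exact: fc.
exact: closed_eq.
Qed.

Lemma is_cozero_setP A : is_cozero_set R A <-> is_zero_set R (~` A).
Proof.
by split=> -[f fc e]; exists f => //; move: e; rewrite /cozero_set setTD;
  [move=> -> | move=> <-]; rewrite setCK.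
Qed.

Lemma cozero_set_open A : is_cozero_set R A -> open A.
Proof. by move/is_cozero_setP/zero_set_closed; rewrite -openC setCK. Qed.

(** Truncating [|f|] at 1 keeps the zeros of [f]. The bound makes the function bounded, as
    C*-extension requires, and later lets a product with it be dominated by the other factor. *)
Lemma is_zero_set_itv01 Z : is_zero_set R Z ->
  exists f, [/\ continuous f, forall x, 0 <= f x <= 1 & Z = zero_set f].
Proof.
case=> f fc ->; exists (fun x => Num.min `|f x| 1); split.
- move=> x.
  apply: (@continuous_min R T (fun x => `|f x|) (cst 1)); last exact: cvg_cst.
  by apply: continuous_comp; [exact: fc | exact: norm_continuous].
- by move=> x; rewrite le_min normr_ge0 ler01 ge_min lexx orbT.
- apply/seteqP; split=> x; rewrite /zero_set /=.
    by move=> ->; rewrite normr0 min_l.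
  by rewrite /Num.min; case: ifP => _ /eqP; rewrite ?oner_eq0 //
    normr_eq0 => /eqP.
Qed.

End ZeroSetTheory.

Section Trace.
Variables (Y : topologicalType) (X : set Y).
Local Notation i := (set_val : set_type X -> Y).

Lemma set_val_continuous : continuous i.
Proof. exact: initial_continuous. Qed.

Lemma open_trace (U : set Y) : open U -> open (i @^-1` U).
Proof. by exists U. Qed.

Lemma is_zero_set_trace (R : realType) (Z : set Y) :
  is_zero_set R Z -> is_zero_set R (i @^-1` Z).
Proof.
case=> f fc ->; exists (f \o i) => // x.
by apply: continuous_comp; [exact: set_val_continuous | exact: fc].
Qed.

Lemma is_cozero_set_trace (R : realType) (A : set Y) :
  is_cozero_set R A -> is_cozero_set R (i @^-1` A).
Proof. by move/is_cozero_setP/is_zero_set_trace=> ?; apply/is_cozero_setP. Qed.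

Lemma dense_trace_eq0 (U : set Y) :
  dense X -> open U -> i @^-1` U = set0 -> U = set0.
Proof.
move=> dX oU U0; apply: contrapT => /eqP/set0P Un0.
have [x [Ux Xx]] := dX U Un0 oU.
suff : (i @^-1` U) (exist _ x (mem_set Xx)) by rewrite U0.
exact: Ux.
Qed.

(** The set [U] minus [Z] is open in [Y] and has empty trace, so it is empty by density. *)
Lemma dense_trace_sub (U Z : set Y) : dense X -> open U -> closed Z ->
  i @^-1` U `<=` i @^-1` Z -> U `<=` Z.
Proof.
move=> dX oU cZ /subsets_disjoint UZ; apply/subsets_disjoint.
by apply: (dense_trace_eq0 dX _ UZ); apply: openI => //; rewrite openC.
Qed.

Lemma trace_interior_sub (Z : set Y) :
  i @^-1` (interior Z) `<=` interior (i @^-1` Z).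
Proof.
rewrite -open_subsetE; first by move=> x; exact: interior_subset.
by apply: open_trace; exact: open_interior.
Qed.

(** An open set of [X] inside the trace of [Z] is the trace of some open [U] of [Y]; density and
    closedness of [Z] then force [U] itself into [Z]. *)
Lemma dense_interior_trace (Z : set Y) : dense X -> closed Z ->
  interior (i @^-1` Z) = i @^-1` (interior Z).
Proof.
move=> dX cZ; apply/seteqP; split; last exact: trace_interior_sub.
move=> x [_ [[U oU <-] Ux UZ]]; suff /(_ _ Ux) : U `<=` interior Z by [].
by rewrite -open_subsetE //; exact: dense_trace_sub.
Qed.

(** If the trace of an open [U] lies in that of [Z], then [U] meets [X] inside [Z], and this
    intersection is open in [Y] because [X] is. *)
Lemma open_interior_trace (Z : set Y) : open X ->
  interior (i @^-1` Z) = i @^-1` (interior Z).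
Proof.
move=> oX; apply/seteqP; split; last exact: trace_interior_sub.
move=> x [_ [[U oU <-] Ux UZ]].
suff : U `&` X `<=` interior Z by apply; split=> //; exact: set_valP.
rewrite -open_subsetE; last exact: openI.
by move=> y [Uy Xy]; exact: (UZ (exist _ y (mem_set Xy))).
Qed.

(** Being a neighbourhood of [i x] is being a set whose interior contains [i x], and interiors
    commute with traces on an open [X]. *)
Lemma open_continuous_at (S : topologicalType) (h : Y -> S) (x : set_type X) :
  open X -> {for x, continuous (h \o i)} -> {for i x, continuous h}.
Proof.
move=> oX hx V hV; have : interior (i @^-1` (h @^-1` V)) x by exact: hx.
by rewrite open_interior_trace.
Qed.

End Trace.

Section WCFTransfer.
Variables (R : realType) (Y : topologicalType) (X : set Y).
Local Notation i := (set_val : set_type X -> Y).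

Lemma z_embedded_cozero (C : set (set_type X)) : z_embedded R X ->
  is_cozero_set R C -> exists2 D : set Y, is_cozero_set R D & C = i @^-1` D.
Proof.
move=> zX /is_cozero_setP/zX[Z Z0 CZ]; exists (~` Z).
  by apply/is_cozero_setP; rewrite setCK.
by rewrite -[C]setCK CZ.
Qed.

Lemma dense_z_embedded_WCF : dense X -> z_embedded R X ->
  WCF_space R (set_type X) <-> WCF_space R Y.
Proof.
move=> dX zX; split=> wcf A B.
  move=> cA cB AB0; have [|||Z1 [Z2 []]] := wcf (i @^-1` A) (i @^-1` B).
  - exact: is_cozero_set_trace.
  - exact: is_cozero_set_trace.
  - by rewrite -preimage_setI AB0 preimage_set0.
  (* The separating zero-sets of [X] are traces of zero-sets [W1], [W2] of [Y]. These are closed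
     while [A] and [B] are open, so the inclusions lift by density. *)
  move=> /zX[W1 zW1 ->] /zX[W2 zW2 ->] AW1 BW2.
  have [cW1 cW2] := (zero_set_closed zW1, zero_set_closed zW2).
  rewrite !dense_interior_trace // -preimage_setI => W0.
  exists W1, W2; split=> //.
  - by apply: (dense_trace_sub dX) => //; exact: cozero_set_open cA.
  - by apply: (dense_trace_sub dX) => //; exact: cozero_set_open cB.
  - by apply: (dense_trace_eq0 dX _ W0); apply: openI; exact: open_interior.
(* Conversely, the given cozero-sets of [X] are traces of cozero-sets [C], [D] of [Y], which are
   disjoint since their open intersection has empty trace. *)
move=> /(z_embedded_cozero zX)[C cC ->] /(z_embedded_cozero zX)[D cD ->].
rewrite -preimage_setI => CD0.
have [|||Z1 [Z2 [zZ1 zZ2 CZ1 DZ2 Z0]]] := wcf C D => //.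
  by apply: (dense_trace_eq0 dX _ CD0); apply: openI;
    [exact: cozero_set_open cC | exact: cozero_set_open cD].
exists (i @^-1` Z1), (i @^-1` Z2); split.
- exact: is_zero_set_trace.
- exact: is_zero_set_trace.
- by move=> x; exact: CZ1.
- by move=> x; exact: DZ2.
rewrite !dense_interior_trace //;
  [|exact: zero_set_closed zZ2|exact: zero_set_closed zZ1].
by rewrite -preimage_setI Z0 preimage_set0.
Qed.

Lemma Cstar_embedded_z_embedded : Cstar_embedded R X -> z_embedded R X.
Proof.
move=> CX W /is_zero_set_itv01[f [fc f01 ->]].
have [|g [gc _ gf]] := CX f fc.
  exists 1; split; first exact: num_real.
  move=> M M1 x _ /=; have /andP[f0 f1] := f01 x.
  by rewrite ger0_norm // (le_trans f1) // ltW.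
exists (zero_set g); first by exists g.
by apply/seteqP; split=> x; rewrite /zero_set /= gf.
Qed.

(* If [X] is the cozero-set of [f] and [C] that of [g : X -> [0, 1]], then [C]
   is the cozero-set in [Y] of [f * g], extended by [0] off [X]. *)
Lemma cozero_set_image (C : set (set_type X)) : is_cozero_set R X ->
  is_cozero_set R C -> is_cozero_set R (i @` C).
Proof.
move=> cX /is_cozero_setP/is_zero_set_itv01[g [gc g01 gC]].
have oX := cozero_set_open cX.
have [f fc Xf] := cX.
have Xf0 x : X x <-> f x <> 0.
  by rewrite Xf /cozero_set /zero_set /=; split=> [[]|].
(* The default value 0 off [X] may create jumps of [g0] at the boundary of [X]; the factor [f]
   vanishes there. *)
pose g0 x := oapp g 0 (insub x : option (set_type X)).
have g0i (x : set_type X) : g0 (i x) = g x by rewrite /g0 set_valE valK.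
have g001 x : 0 <= g0 x <= 1.
  by rewrite /g0; case: insubP => [u _ _|_] /=; rewrite ?g01 // lexx ler01.
have g0C x : (i @` C) x <-> f x * g0 x <> 0.
  split=> [[{}x Cx <-]|/eqP].
    apply/eqP; rewrite g0i mulf_neq0 //; first exact/eqP/Xf0/set_valP.
    by apply/eqP => gx0; have : (~` C) x by rewrite gC.
  rewrite mulf_eq0 negb_or => /andP[/eqP/Xf0 Xx].
  pose u : set_type X := exist _ x (mem_set Xx).
  rewrite -[x]/(i u) g0i => /eqP gu; exists u => //.
  by apply: contrapT => nCu; apply: gu; have : (~` C) u by []; rewrite gC.
exists (f \* g0); last first.
  by apply/seteqP; split=> x; rewrite /cozero_set /zero_set /=;
    [move/g0C | case=> _ /g0C].
(* At a point of the open set [X], continuity can be checked on [X], where the function is a product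
   of continuous ones. *)
move=> x; have [Xx|nXx] := pselect (X x).
  apply: (@open_continuous_at _ X _ _ (exist _ x (mem_set Xx))) => //.
  have -> : (f \* g0) \o i = (f \o i) \* g.
    by apply/funext => y /=; rewrite g0i.
  apply: continuousM; last exact: gc.
  by apply: continuous_comp; [exact: set_val_continuous | exact: fc].
(* Off [X] the product vanishes, and its absolute value is at most [|f|], which tends to 0 at
   [x]. *)
have fx0 : f x = 0 by apply: contrapT => /Xf0.
rewrite /continuous_at /= fx0 mul0r; apply/norm_cvg0P.
apply: (@squeeze_cvgr _ _ _ _ (cst 0) (fun y => `|f y|)).
- near=> y => /=; rewrite normr_ge0 normrM /=.
  have /andP[g0y g1y] := g001 y.
  by rewrite ler_piMr // ger0_norm.
- exact: cvg_cst.
- by rewrite -[0](@normr0 _ R) -fx0; apply: cvg_norm; exact: fc.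
Unshelve. all: by end_near.
Qed.

Lemma cozero_set_WCF :
  WCF_space R Y -> is_cozero_set R X -> WCF_space R (set_type X).
Proof.
move=> wcf cX A B cA cB AB0; have oX := cozero_set_open cX.
have [|||Z1 [Z2 [zZ1 zZ2 AZ1 BZ2 Z0]]] := wcf (i @` A) (i @` B).
- exact: cozero_set_image.
- exact: cozero_set_image.
- apply/disjoints_subset => _ [x Ax <-] [y By /val_inj yx].
  by rewrite -[False]/(set0 x) -AB0; split=> //; rewrite -yx.
exists (i @^-1` Z1), (i @^-1` Z2); split.
- exact: is_zero_set_trace.
- exact: is_zero_set_trace.
- by move=> x Ax; apply: AZ1; exists x.
- by move=> x Bx; apply: BZ2; exists x.
(* Interiors commute with traces here because the cozero-set [X] is open. *)
by rewrite !open_interior_trace // -preimage_setI Z0 preimage_set0.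
Qed.

End WCFTransfer.

Theorem theorem3p13 (R : realType) :
  (forall (Y : topologicalType) (X : set Y),
     tychonoff_space Y -> dense X -> z_embedded R X ->
     (WCF_space R (set_type X) <-> WCF_space R Y)) /\
  (forall (Y : topologicalType) (X : set Y),
     tychonoff_space Y -> dense X -> Cstar_embedded R X ->
     (WCF_space R (set_type X) <-> WCF_space R Y)) /\
  (forall (X : topologicalType) (A : set X),
     tychonoff_space X -> WCF_space R X -> is_cozero_set R A ->
     WCF_space R (set_type A)).
Proof.
split; first by move=> Y X _; exact: dense_z_embedded_WCF.
split; last by move=> X A _; exact: cozero_set_WCF.
move=> Y X _ dX /Cstar_embedded_z_embedded; exact: dense_z_embedded_WCF.
Qed.
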